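(* For every fixed polynomial $f\in\mathbb{R}[\lambda]$ there is a constant $C_f$ such that for every odd prime $p$, \[ \left|\frac{1}{|M(\mathbb{F}_p)|}\sum_j f(\lambda_j)-\int_{-2\sqrt2}^{2\sqrt2}f(\lambda)\rho_3(\lambda)\,d\lambda\right|\le\frac{C_f}{p}. \]
   Context: Let $p$ be an odd prime. $M(\mathbb{F}_p)$ denotes the set of triples $(x,y,z)\in\mathbb{F}_p^3\setminus\{(0,0,0)\}$ satisfying $x^2+y^2+z^2=xyz$. The Markoff moves are the maps $m_1(x,y,z)=(yz-x,y,z)$, $m_2(x,y,z)=(x,xz-y,z)$, $m_3(x,y,z)=(x,y,xy-z)$; each is an involution of $M(\mathbb{F}_p)$. The Markoff graph mod $p$ has vertex set $M(\mathbb{F}_p)$ and adjacency matrix $A=P_1+P_2+P_3$, where $P_i$ is the permutation matrix of $m_i$ (i.e. $(P_i)_{uv}=1$ iff $v=m_i(u)$, else $0$). $A$ is a real symmetric matrix with row sums $3$; let $\lambda_j$ denote its eigenvalues listed with multiplicity (they lie in $[-3,3]$). One has $|M(\mathbb{F}_p)|=p^2+3\left(\frac{-1}{p}\right)p$. The Kesten–McKay density for degree 3 is $\rho_3(\lambda)=\frac{3}{2\pi}\frac{\sqrt{8-\lambda^2}}{9-\lambda^2}\mathbf{1}_{[-2\sqrt2,2\sqrt2]}(\lambda)$. *)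

(* Defs.v *)
From Stdlib Require Import Reals ClassicalEpsilon FunctionalExtensionality.
From HB Require Import structures.
From mathcomp Require Import all_boot all_order all_algebra.

Set Implicit Arguments.
Unset Strict Implicit.
Unset Printing Implicit Defensive.

Import GRing.Theory.

Definition Req_bool (x y : R) : bool :=
  if Req_EM_T x y then true else false.

Lemma Req_boolP : Equality.axiom Req_bool.
Proof. move=> x y; rewrite /Req_bool; case: Req_EM_T => h; by constructor. Qed.

HB.instance Definition _ := hasDecEq.Build R Req_boolP.

Definition R_find (P : pred R) (_ : nat) : option R :=
  match excluded_middle_informative (exists x, P x) with
  | left h => Some (proj1_sig (constructive_indefinite_description _ h))
  | right _ => None
  end.

Lemma R_find_correct P n x : R_find P n = Some x -> P x.
Proof.
rewrite /R_find; case: excluded_middle_informative => // h [<-].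
by case: constructive_indefinite_description.
Qed.

Lemma R_find_complete (P : pred R) : (exists x, P x) -> exists n, R_find P n.
Proof.
move=> h; exists 0%N; rewrite /R_find.
by case: excluded_middle_informative.
Qed.

Lemma R_find_ext (P Q : pred R) : P =1 Q -> R_find P =1 R_find Q.
Proof. by move=> /functional_extensionality ->. Qed.

HB.instance Definition _ :=
  hasChoice.Build R R_find_correct R_find_complete R_find_ext.

Lemma R_addrA : ssrfun.associative Rplus.
Proof. move=> x y z; by rewrite Rplus_assoc. Qed.
Lemma R_addrC : ssrfun.commutative Rplus.
Proof. exact: Rplus_comm. Qed.
Lemma R_add0r : ssrfun.left_id R0 Rplus.
Proof. exact: Rplus_0_l. Qed.
Lemma R_addNr : ssrfun.left_inverse R0 Ropp Rplus.
Proof. move=> x; by rewrite Rplus_comm Rplus_opp_r. Qed.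

HB.instance Definition _ :=
  GRing.isZmodule.Build R R_addrA R_addrC R_add0r R_addNr.

Lemma R_mulrA : ssrfun.associative Rmult.
Proof. move=> x y z; by rewrite Rmult_assoc. Qed.
Lemma R_mulrC : ssrfun.commutative Rmult.
Proof. exact: Rmult_comm. Qed.
Lemma R_mul1r : ssrfun.left_id R1 Rmult.
Proof. exact: Rmult_1_l. Qed.
Lemma R_mulrDl : ssrfun.left_distributive Rmult Rplus.
Proof. move=> x y z; by rewrite Rmult_plus_distr_r. Qed.
Lemma R_oner_neq0 : (R1 : R) != R0.
Proof. apply/eqP; exact: R1_neq_R0. Qed.

HB.instance Definition _ :=
  GRing.Zmodule_isComNzRing.Build R R_mulrA R_mulrC R_mul1r R_mulrDl R_oner_neq0.

Local Open Scope ring_scope.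

Definition triple (p : nat) := ('F_p * 'F_p * 'F_p)%type.

Definition markoffb (p : nat) (t : triple p) : bool :=
  let: (x, y, z) := t in
  (t != (0, 0, 0)) && (x ^+ 2 + y ^+ 2 + z ^+ 2 == x * y * z).

Definition Markoff (p : nat) := {t : triple p | markoffb t}.

Definition mv1 (p : nat) (t : triple p) : triple p :=
  let: (x, y, z) := t in (y * z - x, y, z).
Definition mv2 (p : nat) (t : triple p) : triple p :=
  let: (x, y, z) := t in (x, x * z - y, z).
Definition mv3 (p : nat) (t : triple p) : triple p :=
  let: (x, y, z) := t in (x, y, x * y - z).

Definition vtx (p : nat) (i : 'I_#|{: Markoff p}|) : triple p :=
  val (enum_val i).

Definition perm_matrix (p : nat) (m : triple p -> triple p)
  : 'M[R]_#|{: Markoff p}| :=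
  \matrix_(i, j) ((m (vtx i) == vtx j)%:R : R).

Definition markoff_adj (p : nat) : 'M[R]_#|{: Markoff p}| :=
  perm_matrix (@mv1 p) + perm_matrix (@mv2 p) + perm_matrix (@mv3 p).

Definition eigenvalues_with_mult (n : nat) (A : 'M[R]_n) (s : seq R) : Prop :=
  char_poly A = \prod_(l <- s) ('X - l%:P).

Local Close Scope ring_scope.

(* ---------- Kesten--McKay density for degree 3 ---------- *)

Open Scope R_scope.

Definition rho3 (l : R) : R :=
  if Rle_dec (- (2 * sqrt 2)) l then
    if Rle_dec l (2 * sqrt 2) then
      3 / (2 * PI) * (sqrt (8 - l ^ 2) / (9 - l ^ 2))
    else 0
  else 0.

Close Scope R_scope.

(* Main.v *)
(** The trace of the degree-[d] non-backtracking polynomial [q_d] of the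
    adjacency matrix counts the fixed points of the reduced words of length [d]
    in the involutions [m_1, m_2, m_3], while [q_d] is orthogonal to [1] for the
    Kesten-McKay density when [d > 0].  So it is enough that a nontrivial reduced
    word fixes [O(p)] points and that [M(F_p)] has at least about [p ^ 2 / 2]
    points.

    If the first letter applied by the word is [m_i], fix the value [c] of the
    [i]-th coordinate.  For [c] outside [0, 2, -2] the fibre is a conic which,
    over a field containing [u] with [u + 1 / u = c], is parametrised by a
    nonzero [s], all coordinates being Laurent polynomials in [s] with poles of
    order [0, 1, 1] at infinity.  Each letter of the reduced word strictly
    increases the pole order of the coordinate that it modifies, so the word
    moves the generic point of the fibre and fixes at most [2 ^ (d + 1)] points. *)

Require Import Defs.
From Stdlib Require Import Reals Lra.
From Coquelicot Require Import Coquelicot.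
From HB Require Import structures.
From mathcomp Require Import all_boot all_order all_algebra closed_field.

Set Implicit Arguments.
Unset Strict Implicit.
Unset Printing Implicit Defensive.

Import GRing.Theory.

Local Open Scope R_scope.

(** * The Kesten-McKay density and its orthogonal polynomials *)

Definition theta_param (t : R) : R := - (2 * sqrt 2) * cos t.

(** The pull-back of [rho3] along [theta_param], Jacobian included. The square root disappears,
    which makes explicit antiderivatives on [0, PI] available. *)
Definition theta_density (t : R) : R :=
  3 / (2 * PI) * (8 * sin t ^ 2 / (1 + 8 * sin t ^ 2)).

Definition is_theta_RInt (f : R -> R) (v : R) : Prop :=
  is_RInt (fun t => f (theta_param t) * theta_density t) 0 PI v.

Lemma sqrt2_sqr : sqrt 2 * sqrt 2 = 2.
Proof. by apply: sqrt_sqrt; lra. Qed.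

Lemma theta_param_sqr t : theta_param t ^ 2 = 8 - 8 * sin t ^ 2.
Proof.
have := sin2_cos2 t; rewrite /Rsqr => sc.
have -> : theta_param t ^ 2 = 4 * (sqrt 2 * sqrt 2) * (cos t * cos t).
  by rewrite /theta_param; ring.
by rewrite sqrt2_sqr (_ : cos t * cos t = 1 - sin t * sin t); [ring | lra].
Qed.

Lemma theta_density_den t : 0 < 1 + 8 * sin t ^ 2.
Proof. by have := pow2_ge_0 (sin t); lra. Qed.

Lemma is_RInt_rho3 (f : R -> R) v :
  (forall x, continuous f x) -> is_theta_RInt f v ->
  is_RInt (fun l => f l * rho3 l) (- (2 * sqrt 2)) (2 * sqrt 2) v.
Proof.
move=> cf Jf; have s2 := sqrt2_sqr.
have s2p : 0 < sqrt 2 by apply: sqrt_lt_R0; lra.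
pose h l := f l * (3 / (2 * PI) * (sqrt (8 - l ^ 2) / (9 - l ^ 2))).
have ch z : z ^ 2 <= 8 -> continuous h z.
  move=> z8; apply: (continuous_mult f) => //.
  apply: continuous_mult; first exact: continuous_const.
  apply: continuous_mult.
    apply: continuous_comp; last exact: continuous_sqrt.
    by apply: ex_derive_continuous; auto_derive.
  by apply: ex_derive_continuous; auto_derive; lra.
have dg t : is_derive theta_param t (2 * sqrt 2 * sin t).
  by rewrite /theta_param; auto_derive => //; ring.
have cdg t : continuous (fun t => 2 * sqrt 2 * sin t) t.
  by apply: ex_derive_continuous; auto_derive.
have chg t : continuous h (theta_param t).
  by apply: ch; rewrite theta_param_sqr; have := pow2_ge_0 (sin t); lra.
have := is_RInt_comp h theta_param (fun t => 2 * sqrt 2 * sin t) 0 PI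
  (fun t _ => chg t) (fun t _ => conj (dg t) (cdg t)).
have -> : theta_param 0 = - (2 * sqrt 2) by rewrite /theta_param cos_0; ring.
have -> : theta_param PI = 2 * sqrt 2 by rewrite /theta_param cos_PI; ring.
move=> Jh.
have {}Jf : is_RInt (fun t => scal (2 * sqrt 2 * sin t) (h (theta_param t))) 0 PI v.
  apply: is_RInt_ext Jf => t; rewrite Rmin_left ?Rmax_right; try exact: Rlt_le PI_RGT_0.
  move=> [t0 tP]; have sp : 0 < sin t by exact: sin_gt_0.
  rewrite /h theta_param_sqr /scal /= /mult /= /theta_density.
  have -> : 8 - (8 - 8 * sin t ^ 2) = (2 * sqrt 2 * sin t) ^ 2.
    transitivity (4 * (sqrt 2 * sqrt 2) * sin t ^ 2); last by ring.
    by rewrite s2; ring.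
  rewrite sqrt_pow2; last nra.
  have -> : 8 * sin t ^ 2 = (sqrt 2 * sqrt 2) * 4 * sin t ^ 2 by rewrite s2; ring.
  have den := theta_density_den t; have PIp := PI_RGT_0.
  have -> : 9 - (8 - sqrt 2 * sqrt 2 * 4 * sin t ^ 2) = 1 + sqrt 2 * sqrt 2 * 4 * sin t ^ 2 by ring.
  have : 1 + sqrt 2 * sqrt 2 * 4 * sin t ^ 2 <> 0 by rewrite s2; lra.
  by move=> den0; field; split => //; lra.
(* The substitution only identifies [v] with [RInt h]; that [h] is integrable follows from its
   continuity on the closed interval. *)
rewrite -(is_RInt_unique _ _ _ _ Jf) (is_RInt_unique _ _ _ _ Jh).
apply: (is_RInt_ext h) => [l|].
  rewrite Rmin_left ?Rmax_right; try lra; move=> [l1 l2].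
  by rewrite /h /rho3; case: Rle_dec => ?; [case: Rle_dec => ? //|]; exfalso; lra.
apply: RInt_correct; apply: ex_RInt_continuous => z.
rewrite Rmin_left ?Rmax_right; try lra; move=> [z1 z2]; apply: ch.
have -> : 8 = 4 * (sqrt 2 * sqrt 2) by rewrite s2; ring.
nra.
Qed.

Fixpoint cheb_rec (a : nat -> R) (d : nat) (x : R) : R :=
  match d with
  | 0%nat => 1
  | S d' => match d' with
    | 0%nat => x
    | S d'' => x * cheb_rec a d' x - a d'' * cheb_rec a d'' x
    end
  end.

(** The Chebyshev polynomial of the second kind, rescaled: 2 ^ (d / 2) U_d (x / (2 sqrt 2)). *)
Definition Ucheb := cheb_rec (fun _ => 2).

(* The spherical function: [kmpoly d] of the adjacency operator of the 3-regular
   tree counts the non-backtracking walks of length [d]. *)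
Definition kmpoly := cheb_rec (fun d => match d with 0%nat => 3 | S _ => 2 end).

Lemma cheb_recSS a d x :
  cheb_rec a (S (S d)) x = x * cheb_rec a (S d) x - a d * cheb_rec a d x.
Proof. by []. Qed.

Lemma continuous_cheb_rec a d x : continuous (cheb_rec a d) x.
Proof.
suff [] : continuous (cheb_rec a d) x /\ continuous (cheb_rec a (S d)) x by [].
elim: d => [|d [IH0 IH1]].
  by split; [exact: continuous_const | exact: continuous_id].
split => //; apply: (continuous_minus (fun x => x * cheb_rec a (S d) x)).
  by apply: (continuous_mult (fun x => x)) => //; exact: continuous_id.
by apply: (continuous_mult (fun x => a d)) => //; exact: continuous_const.
Qed.

(** The factor 9 - x ^ 2 is the denominator of [rho3]; multiplying by it leaves a semicircle
    density, for which the [Ucheb] are orthogonal. The identity therefore carries orthogonality to 1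
    from one [kmpoly] to the one two degrees higher. *)
Lemma kmpoly_recSSS d x :
  kmpoly (S (S (S d))) x = 4 * kmpoly (S d) x - (9 - x ^ 2) * Ucheb (S d) x.
Proof.
suff [] : kmpoly (S (S (S d))) x = 4 * kmpoly (S d) x - (9 - x ^ 2) * Ucheb (S d) x /\
  kmpoly (S (S (S (S d)))) x = 4 * kmpoly (S (S d)) x - (9 - x ^ 2) * Ucheb (S (S d)) x by [].
elim: d => [|d [IH0 IH1]]; first by split; rewrite /kmpoly /Ucheb /=; ring.
split => //; rewrite [LHS]cheb_recSS -/kmpoly IH1 [Ucheb (S (S (S d))) x]cheb_recSS -/Ucheb.
have k3 : kmpoly (S (S (S d))) x = x * kmpoly (S (S d)) x - 2 * kmpoly (S d) x by [].
lra.
Qed.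

Lemma Ucheb_theta d t :
  Ucheb d (theta_param t) * sin t = (- sqrt 2) ^ d * sin (INR (S d) * t).
Proof.
suff [] : Ucheb d (theta_param t) * sin t = (- sqrt 2) ^ d * sin (INR (S d) * t) /\
  Ucheb (S d) (theta_param t) * sin t = (- sqrt 2) ^ (S d) * sin (INR (S (S d)) * t) by [].
elim: d => [|d [IH0 IH1]].
  rewrite /Ucheb /theta_param /= (_ : (1 + 1) * t = 2 * t); last by ring.
  by rewrite sin_2a; split; rewrite ?Rmult_1_l //; ring.
split => //; rewrite [Ucheb _ _]cheb_recSS -/Ucheb.
transitivity (theta_param t * (Ucheb (S d) (theta_param t) * sin t) -
  2 * (Ucheb d (theta_param t) * sin t)); first ring.
rewrite IH1 IH0.
have -> : INR (S (S (S d))) * t = INR (S (S d)) * t + t by rewrite !S_INR; ring.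
have -> : INR (S d) * t = INR (S (S d)) * t - t by rewrite !S_INR; ring.
rewrite sin_plus sin_minus /theta_param.
have powS n : (- sqrt 2) ^ (S n) = - sqrt 2 * (- sqrt 2) ^ n by [].
rewrite (powS (S d)) (powS d).
set a := sin (INR _ * t); set b := cos (INR _ * t); set r := (- sqrt 2) ^ d.
have := sqrt2_sqr; set s := sqrt 2 => s2.
transitivity (r * (2 * (s * s) * cos t * a - 2 * (a * cos t - b * sin t))); first ring.
transitivity (r * ((s * s) * (a * cos t + b * sin t))); last ring.
rewrite s2; ring.
Qed.

Lemma sin_INR_PI n : sin (INR n * PI) = 0.
Proof.
elim: n => [|n IH]; first by rewrite Rmult_0_l sin_0.
by rewrite S_INR Rmult_plus_distr_r Rmult_1_l neg_sin IH Ropp_0.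
Qed.

Lemma is_RInt_eq (f g : R -> R) a b (v : R) :
  (forall x, f x = g x) -> is_RInt f a b v -> is_RInt g a b v.
Proof. by move=> fg; apply: is_RInt_ext => x _; exact: fg. Qed.

Lemma is_RInt_FTC (F f : R -> R) a b v :
  (forall x, is_derive F x (f x)) -> (forall x, continuous f x) ->
  F b - F a = v -> is_RInt f a b v.
Proof. by move=> dF cf <-; apply: is_RInt_derive. Qed.

(** The denominator of the density cancels, leaving a multiple of sin ((d + 2) t) sin t; the
    product-to-sum formula gives its antiderivative, which vanishes at 0 and PI. *)
Lemma is_theta_RInt_Ucheb d :
  is_theta_RInt (fun x => (9 - x ^ 2) * Ucheb (S d) x) 0.
Proof.
have PIp := PI_RGT_0; set r := (- sqrt 2) ^ (S d).
have m0 : INR (S d) <> 0 by exact: not_0_INR.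
have n0 : INR (S (S (S d))) <> 0 by exact: not_0_INR.
pose g t := 3 / (2 * PI) * 8 * r * (sin (INR (S (S d)) * t) * sin t).
apply: (@is_RInt_eq g) => [t|].
  rewrite /theta_density theta_param_sqr; have den := theta_density_den t.
  have -> : 9 - (8 - 8 * sin t ^ 2) = 1 + 8 * sin t ^ 2 by ring.
  rewrite /g.
  transitivity (3 / (2 * PI) * 8 * (Ucheb (S d) (theta_param t) * sin t) * sin t).
    by rewrite Ucheb_theta -/r; ring.
  by field; split; lra.
apply: (@is_RInt_FTC (fun t => 3 / (2 * PI) * 4 * r *
  (sin (INR (S d) * t) / INR (S d) - sin (INR (S (S (S d))) * t) / INR (S (S (S d)))))).
- move=> t; rewrite /g; auto_derive => //.
  have -> : INR (S (S (S d))) * t = INR (S (S d)) * t + t by rewrite !S_INR; ring.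
  have e : INR (S d) * t = INR (S (S d)) * t - t by rewrite !S_INR; ring.
  by rewrite e cos_plus cos_minus; field; split; [lra | split].
- by move=> t; apply: ex_derive_continuous; rewrite /g; auto_derive.
- by rewrite !sin_INR_PI !Rmult_0_r sin_0 /Rdiv !Rmult_0_l; ring.
Qed.

Lemma is_theta_RInt_9 : is_theta_RInt (fun x => 9 - x ^ 2) 6.
Proof.
have PIp := PI_RGT_0.
apply: (@is_RInt_eq (fun t => 3 / (2 * PI) * 8 * sin t ^ 2)) => [t|].
  rewrite /theta_density theta_param_sqr; have den := theta_density_den t.
  by field; split; lra.
apply: (@is_RInt_FTC (fun t => 3 / (2 * PI) * 4 * (t - sin t * cos t))).
- move=> t; auto_derive => //; have := sin2_cos2 t; rewrite /Rsqr => sc.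
  transitivity (3 / (2 * PI) * 4 *
    ((sin t * sin t + cos t * cos t) + sin t * sin t - cos t * cos t)).
    by rewrite sc; field; lra.
  by field; lra.
- by move=> t; apply: ex_derive_continuous; auto_derive.
- by rewrite sin_0 sin_PI; field; lra.
Qed.

Lemma is_theta_RInt_1 : is_theta_RInt (fun=> 1) 1.
Proof.
have PIp := PI_RGT_0.
have den t : 2 - cos (2 * t) <> 0 by have [] := COS_bound (2 * t); lra.
(* The density is 3 / (2 PI) times 1 - 1 / (1 + 8 sin^2 t), and the last fraction has antiderivative
   atan (3 tan t) / 3. Writing atan (3 tan t) as t + atan (sin 2t / (2 - cos 2t)) removes the jump
   at PI / 2. *)
apply: (@is_RInt_FTC (fun t => 3 / (2 * PI) *
   (t - (t + atan (sin (2 * t) / (2 - cos (2 * t)))) / 3))).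
- move=> t; auto_derive; first by have := den t; repeat split.
  have dent := den t; have := sin2_cos2 (2 * t); rewrite /Rsqr /theta_density => sc.
  have -> : 8 * sin t ^ 2 = 4 - 4 * cos (2 * t) by rewrite cos_2a_sin; ring.
  have [] := COS_bound (2 * t); move: sc dent.
  set C := cos _; set S := sin _ => sc dent C1 C2.
  have SS : S * S = 1 - C * C by lra.
  set M := 2 + - C; have M0 : M <> 0 by rewrite /M; lra.
  have -> : 1 + S * / M * (S * / M * 1) = (5 - 4 * C) / (M * M).
    transitivity ((M * M + S * S) / (M * M)); first by field.
    by rewrite SS /M; congr (_ / _); ring.
  have -> : 2 * 1 * C * / M + S * (- - (2 * 1 * - S) * / (M * M)) = (4 * C - 2) / (M * M).
    transitivity ((2 * C * M - 2 * (S * S)) / (M * M)); first by field.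
    by rewrite SS /M; congr (_ / _); ring.
  by field; repeat split; lra.
- move=> t; apply: ex_derive_continuous; rewrite /theta_density; auto_derive.
  by have := theta_density_den t; lra.
- rewrite Rmult_0_r sin_0 cos_0 sin_2PI cos_2PI /Rdiv !Rmult_0_l atan_0; field; lra.
Qed.

Lemma is_theta_RInt_id : is_theta_RInt (fun x => x) 0.
Proof.
have PIp := PI_RGT_0; have s2 := sqrt2_sqr.
have s2p : 0 < sqrt 2 by apply: sqrt_lt_R0; lra.
apply: (@is_RInt_FTC (fun t => 3 / (2 * PI) * (- (2 * sqrt 2)) *
   (sin t - atan (2 * sqrt 2 * sin t) / (2 * sqrt 2)))).
- move=> t; auto_derive => //; have den := theta_density_den t.
  rewrite /theta_param /theta_density.
  move: den; set s := sin t => den.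
  have -> : 1 + 2 * sqrt 2 * s * (2 * sqrt 2 * s * 1) = 1 + 8 * s ^ 2.
    by transitivity (1 + 4 * (sqrt 2 * sqrt 2) * s ^ 2); [ring | rewrite s2; ring].
  by field; repeat split; lra.
- move=> t; apply: ex_derive_continuous; rewrite /theta_param /theta_density; auto_derive.
  by have := theta_density_den t; lra.
- by rewrite sin_0 sin_PI; ring.
Qed.

Lemma is_theta_RInt_linear f g a b v w :
  is_theta_RInt f v -> is_theta_RInt g w ->
  is_theta_RInt (fun x => a * f x - b * g x) (a * v - b * w).
Proof.
move=> Jf Jg.
pose h t := a * (f (theta_param t) * theta_density t) - b * (g (theta_param t) * theta_density t).
apply: (@is_RInt_eq h) => [t|]; first by rewrite /h; ring.
exact: (is_RInt_minus _ _ _ _ _ _ (is_RInt_scal _ _ _ a _ Jf) (is_RInt_scal _ _ _ b _ Jg)).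
Qed.

Lemma is_theta_RInt_kmpoly d :
  is_theta_RInt (kmpoly d) (if d is 0%nat then 1 else 0).
Proof.
suff H n : is_theta_RInt (kmpoly (S n)) 0 /\ is_theta_RInt (kmpoly (S (S n))) 0.
  by case: d => [|d]; [exact: is_theta_RInt_1 | have [] := H d].
elim: n => [|n [IH0 IH1]]; split => //.
- exact: is_theta_RInt_id.
(* [kmpoly 2] is x ^ 2 - 3 = 6 - (9 - x ^ 2). *)
- have := @is_theta_RInt_linear _ _ 6 1 _ _ is_theta_RInt_1 is_theta_RInt_9.
  rewrite (_ : 6 * 1 - 1 * 6 = 0); last by ring.
  by apply: is_RInt_eq => t; rewrite /kmpoly /=; ring.
- have := @is_theta_RInt_linear _ _ 4 1 _ _ IH0 (is_theta_RInt_Ucheb n).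
  rewrite (_ : 4 * 0 - 1 * 0 = 0); last by ring.
  by apply: is_RInt_eq => t; rewrite kmpoly_recSSS; ring.
Qed.

Lemma is_RInt_kmpoly_rho3 d :
  is_RInt (fun l => kmpoly d l * rho3 l) (- (2 * sqrt 2)) (2 * sqrt 2)
    (if d is 0%nat then 1 else 0).
Proof.
apply: is_RInt_rho3; last exact: is_theta_RInt_kmpoly.
by move=> x; exact: continuous_cheb_rec.
Qed.

From mathcomp Require Import zify ring.

Local Close Scope R_scope.

Local Open Scope ring_scope.

(** * Traces from the roots of the characteristic polynomial *)

Lemma R_mulVf (x : R) : x != 0 -> Rinv x * x = 1.
Proof. by move=> /eqP; exact: Rinv_l. Qed.

HB.instance Definition _ := GRing.ComNzRing_isField.Build R R_mulVf Rinv_0.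

(** Gaussian elimination writes a row of rank one as a multiple of the first row of the invertible
    matrix [row_ebase v]. *)
Lemma unitmx_extend_row (F : fieldType) n (v : 'rV[F]_n.+1) :
  v != 0 -> exists2 B : 'M_n.+1, B \in unitmx & row 0 B = v.
Proof.
move=> v0; have rv : \rank v = 1%N by rewrite rank_rV v0.
pose a := col_ebase v 0 0.
have ev : v = a *: row 0 (row_ebase v).
  rewrite -{1}(mulmx_ebase v) rv -mulmxA.
  apply/rowP => j; rewrite !mxE big_ord1 !mxE; congr (_ * _).
  rewrite (bigD1 0) //= big1 => [|i i0]; first by rewrite !mxE eqxx mul1r addr0.
  rewrite !mxE andbT; case: eqP => [i0'|_]; last by rewrite mul0r.
  by case/eqP: i0; apply: val_inj.
have a0 : a != 0 by apply: contraNneq v0 => a0; rewrite ev a0 scale0r.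
exists (a *: row_ebase v); last by rewrite linearZ /= -ev.
by rewrite unitmxZ ?row_ebase_unit ?unitfE.
Qed.

Lemma char_poly_conj (F : fieldType) n (A B : 'M[F]_n) :
  B \in unitmx -> char_poly (B *m A *m invmx B) = char_poly A.
Proof.
move=> uB; rewrite /char_poly.
have uBp : map_mx polyC B \in unitmx.
  by rewrite unitmxE det_map_mx rmorph_unit // -unitmxE.
have -> : char_poly_mx (B *m A *m invmx B)
        = map_mx polyC B *m char_poly_mx A *m invmx (map_mx polyC B).
  rewrite /char_poly_mx mulmxBr mulmxBl -!map_mxM /=.
  rewrite -scalemx1 -scalemxAr mulmx1 -scalemxAl mulmxV // scalemx1.
  by rewrite !map_mxM map_invmx.
by rewrite !det_mulmx mulrC mulrA -det_mulmx mulVmx // det1 mul1r.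
Qed.

(** Deflation: in a basis that starts with an eigenvector for [l] the matrix is block lower
    triangular, with diagonal blocks [l] and [D], and the characteristic polynomial of [D] has the
    remaining roots. *)
Lemma trace_exp_char_poly (F : fieldType) (s : seq F) n (A : 'M[F]_n) k :
  char_poly A = \prod_(l <- s) ('X - l%:P) ->
  \tr (A ^+ k) = \sum_(l <- s) l ^+ k.
Proof.
elim: s n A => [|l s IH] n A.
  rewrite !big_nil => /(congr1 (fun q : {poly F} => size q)).
  rewrite size_char_poly size_poly1 => -[n0]; subst n.
  by rewrite /mxtrace big_ord0.
case: n A => [|n] A.
  move=> /(congr1 (fun q : {poly F} => size q)).
  by rewrite size_char_poly size_prod_XsubC.
rewrite !big_cons => cA.
have /eigenvalueP [v vA v0] : eigenvalue A l.
  by rewrite eigenvalue_root_char cA rootM root_XsubC eqxx.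
have [B uB rB] := unitmx_extend_row v0.
pose A1 : 'M_(1 + n) := B *m A *m invmx B.
have r1 : row 0 A1 = l *: delta_mx 0 0.
  rewrite /A1 -mulmxA row_mul rB mulmxA vA -scalemxAl -rB.
  by rewrite -row_mul mulmxV // row1.
have ur : ursubmx A1 = 0.
  apply/matrixP => i j; rewrite !mxE; have -> : lshift n i = 0 by apply/val_inj; case: i => -[].
  by have /rowP/(_ (rshift 1 j)) := r1; rewrite !mxE /= mulr0.
have ul : ulsubmx A1 = l%:M.
  apply/matrixP => i j; rewrite !mxE !ord1 eqxx.
  have -> : lshift n 0 = 0 :> 'I_(1 + n) by apply/val_inj.
  by have /rowP/(_ 0) := r1; rewrite !mxE /= mulr1.
pose C := dlsubmx A1; pose D := drsubmx A1.
have eA1 : A1 = block_mx l%:M 0 C D by rewrite -ul -ur submxK.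
have cD : char_poly D = \prod_(i <- s) ('X - i%:P).
  have Xl0 : 'X - l%:P != 0 by rewrite polyXsubC_eq0.
  apply: (mulfI Xl0); rewrite -cA -(char_poly_conj A uB) -/A1 eA1.
  symmetry; change (@char_poly _ (1 + n)%N (block_mx l%:M 0 C D) = ('X - l%:P) * char_poly D).
  rewrite /char_poly /char_poly_mx map_block_mx (scalar_mx_block _ _ 'X).
  rewrite opp_block_mx add_block_mx map_mx0 oppr0 addr0 det_lblock; congr (_ * _).
  by rewrite map_scalar_mx -raddfB /= det_scalar expr1.
have pA1 : A1 ^+ k = B *m A ^+ k *m invmx B.
  elim: k {IH} => [|k IHk]; first by rewrite !expr0 mulmx1 mulmxV.
  by rewrite !exprS IHk /A1 -!mulmxE !mulmxA mulmxKV.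
have [C' blk] : exists C', A1 ^+ k = block_mx (l ^+ k)%:M 0 C' (D ^+ k).
  elim: k {IH pA1} => [|k [C' IHk]].
    by exists 0; rewrite !expr0 -scalar_mx_block.
  exists (C *m (l ^+ k)%:M + D *m C').
  rewrite !exprS IHk [in LHS]eA1 -!mulmxE mulmx_block.
  by rewrite !mul0mx !mulmx0 !addr0 !add0r -scalar_mxM.
rewrite -(IH _ D cD) -[A ^+ k](mulKmx uB) mxtrace_mulC -pA1 blk.
have := @mxtrace_block F 1 n (l ^+ k)%:M 0 C' (D ^+ k).
by rewrite mxtrace_scalar.
Qed.

Lemma trace_horner_char_poly (F : fieldType) (s : seq F) n (A : 'M[F]_n.+1) f :
  char_poly A = \prod_(l <- s) ('X - l%:P) ->
  \tr (horner_mx A f) = \sum_(l <- s) f.[l].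
Proof.
move=> cA; rewrite (eq_bigr _ (fun l _ => horner_coef f l)) exchange_big /=.
rewrite -{1}(coefK f) poly_def !raddf_sum /=; apply: eq_bigr => i _.
by rewrite linearZ /= rmorphXn /= horner_mx_X mxtraceZ (trace_exp_char_poly _ cA) mulr_sumr.
Qed.

(** * Coordinate indices modulo 3 and reduced words *)

Lemma ord3P (i j : 'I_3) : [\/ j = i, j = i + 1 | j = i + 2%:R].
Proof.
have : [|| j == i, j == i + 1 | j == i + 2%:R].
  by case: i j => [[|[|[|//]]] ?] [[|[|[|//]]] ?].
by case/or3P => /eqP; [constructor 1 | constructor 2 | constructor 3].
Qed.

Lemma ord3_neq (i : 'I_3) : ((i + 1 == i) = false) * ((i + 2%:R == i) = false)
  * ((i == i + 1) = false) * ((i == i + 2%:R) = false)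
  * ((i + 1 == i + 2%:R) = false) * ((i + 2%:R == i + 1) = false).
Proof. by case: i => [[|[|[|//]]] ?]. Qed.

Lemma ord3_addA (i : 'I_3) : (i + 1 + 1 = i + 2%:R) * (i + 1 + 2%:R = i)
  * (i + 2%:R + 1 = i) * (i + 2%:R + 2%:R = i + 1).
Proof. by case: i => [[|[|[|//]]] ?]; do !split; apply/val_inj. Qed.

Definition reduced (w : seq 'I_3) := sorted (fun i j : 'I_3 => i != j) w.


(** * Growth of pole orders along a reduced word *)

Section Tracking.
Variable K : fieldType.
Implicit Types (v : 'I_3 -> K) (e : 'I_3 -> nat) (P : 'I_3 -> {poly K}).

Definition vmove (i : 'I_3) v : 'I_3 -> K :=
  fun j => if j == i then v (i + 1) * v (i + 2%:R) - v i else v j.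

(* [P j] is [v j], a Laurent polynomial in [s], multiplied by [s ^ e j]. The
   degree of [P j] will be [2 * e j], so [e j] is also the order of the pole of
   [v j] at infinity. *)
Definition tracked (s : K) v e P := forall j, v j * s ^+ e j = (P j).[s].

Definition emove (i : 'I_3) e : 'I_3 -> nat :=
  fun j => if j == i then (e (i + 1)%R + e (i + 2%:R)%R)%N else e j.

(** The power of ['X] brings [v i] to the new common denominator. Its exponent is a truncated
    subtraction, exact under the hypothesis of [tracked_move]. *)
Definition pmove (i : 'I_3) e P : 'I_3 -> {poly K} := fun j =>
  if j == i
  then P (i + 1) * P (i + 2%:R) - P i * 'X^(e (i + 1)%R + e (i + 2%:R)%R - e i)
  else P j.

Lemma tracked_move s v e P i :
  (e i <= e (i + 1)%R + e (i + 2%:R)%R)%N -> tracked s v e P ->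
  tracked s (vmove i v) (emove i e) (pmove i e P).
Proof.
move=> le_e trk j; rewrite /vmove /emove /pmove; case: ifP => // _.
rewrite hornerD hornerN !hornerM hornerXn -!trk mulrBl -[v i * _ * _]mulrA.
by rewrite -[s ^+ e i * _]exprD subnKC // exprD; ring.
Qed.

(** The product has degree 2 (e (i + 1) + e (i + 2)), the subtracted term only e i + e (i + 1) + e
    (i + 2), so the leading term survives. *)
Lemma size_pmove e P i :
  (e i < e (i + 1)%R + e (i + 2%:R)%R)%N ->
  (forall j, size (P j) = (e j).*2.+1) ->
  forall j, size (pmove i e P j) = (emove i e j).*2.+1.
Proof.
move=> lt_e szP j; rewrite /emove /pmove; case: ifP => // _.
have P0 k : P k != 0 by rewrite -size_poly_gt0 szP.
have szPP : size (P (i + 1) * P (i + 2%:R)) = (e (i + 1)%R + e (i + 2%:R)%R).*2.+1.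
  by rewrite size_mul // !szP; lia.
rewrite size_polyDl ?size_polyN szPP //.
apply: leq_ltn_trans (size_polyMleq _ _) _; rewrite szP size_polyXn; lia.
Qed.

(** [foldr] applies the last letter first, and the initial order is 0 exactly there. After a letter
    [l] the order at [l] is the sum of the two others, all positive; any different letter then meets
    the strict inequality of [size_pmove]. Each letter at most doubles the largest order. *)
Lemma reduced_word_tracked e0 P0 l w :
  (forall j, e0 j = (j != last l w) :> nat) ->
  (forall j, size (P0 j) = (e0 j).*2.+1) -> reduced (l :: w) ->
  exists e P, [/\ forall j, size (P j) = (e j).*2.+1, forall j, (0 < e j)%N,
    e l = (e (l + 1)%R + e (l + 2%:R)%R)%N, forall j, (e j <= 2 ^ (size w).+1)%N &
    forall s v, tracked s v e0 P0 -> tracked s (foldr vmove v (l :: w)) e P].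
Proof.
move=> + sz0; elim: w l => [|l' w IH] l /= e0E.
  move=> _; exists (emove l e0), (pmove l e0 P0).
  have lt_e : (e0 l < e0 (l + 1)%R + e0 (l + 2%:R)%R)%N by rewrite !e0E !ord3_neq eqxx.
  split; first exact: size_pmove.
  - move=> j; rewrite /emove !e0E !ord3_neq.
    by case: ifP => // ->.
  - by rewrite /emove eqxx !ord3_neq.
  - by move=> j; rewrite /emove !e0E !ord3_neq; case: ifP => // ->.
  - by move=> s v; apply: tracked_move; exact: ltnW.
move=> /andP[ll' red].
have [e [P [szP e_gt0 el' le_e trk]]] := IH l' e0E red.
have lt_e : (e l < e (l + 1)%R + e (l + 2%:R)%R)%N.
  have := e_gt0 l; have := e_gt0 (l + 1); have := e_gt0 (l + 2%:R).
  case: (ord3P l l') ll' el' => ->; rewrite ?eqxx // !ord3_addA; lia.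
exists (emove l e), (pmove l e P); split; first exact: size_pmove.
- move=> j; rewrite /emove; case: ifP => // _; rewrite addn_gt0 e_gt0 //.
- by rewrite /emove eqxx !ord3_neq.
- move=> j; rewrite /emove /= expnS mul2n -addnn; case: ifP => _; first exact: leq_add.
  exact: leq_trans (le_e j) (leq_addr _ _).
- by move=> s v /trk; apply: tracked_move; exact: ltnW.
Qed.

(** [Q] is the numerator of the change in coordinate [l], the last one modified. The order there
    grows from at most 1 to at least 2, so the leading term of [P l] is not cancelled. *)
Lemma fixed_point_poly e0 P0 l w :
  (forall j, e0 j = (j != last l w) :> nat) ->
  (forall j, size (P0 j) = (e0 j).*2.+1) -> reduced (l :: w) ->
  exists2 Q : {poly K}, Q != 0 & (size Q <= (2 ^ (size w).+2).+1)%N /\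
    forall s v, tracked s v e0 P0 -> foldr vmove v (l :: w) l = v l -> root Q s.
Proof.
move=> e0E sz0 red.
have [e [P [szP e_gt0 el le_e trk]]] := reduced_word_tracked e0E sz0 red.
have lt_e : (e0 l < e l)%N.
  by rewrite e0E el; have := e_gt0 (l + 1); have := e_gt0 (l + 2%:R); case: eqP; lia.
exists (P l - P0 l * 'X^(e l - e0 l)).
  rewrite -size_poly_gt0 size_polyDl ?size_polyN szP //.
  by apply: leq_ltn_trans (size_polyMleq _ _) _; rewrite sz0 size_polyXn; lia.
split.
  rewrite size_polyDl ?size_polyN szP.
    by rewrite ltnS expnS mul2n leq_double.
  by apply: leq_ltn_trans (size_polyMleq _ _) _; rewrite sz0 size_polyXn; lia.
move=> s v trk0 fixl; rewrite /root hornerD hornerN hornerM hornerXn.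
by rewrite -(trk s v trk0) -(trk0 l) fixl -mulrA -exprD subnKC ?subrr // ltnW.
Qed.

End Tracking.

(** * Counting the fixed points of a reduced word *)

Section FixedPoints.
Variable p : nat.
Hypothesis p_pr : prime p.
Implicit Types (t : triple p) (i : 'I_3) (w : seq 'I_3).

Definition coord t i : 'F_p := let: (x, y, z) := t in nth 0 [:: x; y; z] i.

Definition mv i : triple p -> triple p := nth (@mv1 p) [:: @mv1 p; @mv2 p; @mv3 p] i.

Arguments mv : simpl never.

Definition word_act w t : triple p := foldr mv t w.

Lemma coord_inj t t' : coord t =1 coord t' -> t = t'.
Proof.
case: t t' => [[x y] z] [[x' y'] z'] E.
have := (E 0, E 1, E 2%:R) => -[[/= -> ->]]; by rewrite /coord /= => ->.
Qed.

Lemma coord_mv i t : coord (mv i t) =1 vmove i (coord t).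
Proof.
case: t => [[x y] z]; case: i => [[|[|[|//]]] ?] [[|[|[|//]]] ?] //=;
by rewrite /vmove /coord /= // mulrC.
Qed.

Lemma coord_word_act (K : fieldType) (iota : {rmorphism 'F_p -> K}) w t :
  iota \o coord (word_act w t) =1 foldr (@vmove K) (iota \o coord t) w.
Proof.
elim: w => //= i w IH j; rewrite /= coord_mv /vmove -!IH /=.
by case: ifP => _; rewrite ?rmorphB ?rmorphM.
Qed.

Lemma markoff_coord i t : markoffb t ->
  coord t i ^+ 2 + coord t (i + 1) ^+ 2 + coord t (i + 2%:R) ^+ 2
  = coord t i * coord t (i + 1) * coord t (i + 2%:R).
Proof.
case: t => [[x y] z] /andP[_ /eqP E].
by case: i => [[|[|[|//]]] ?]; rewrite /coord /=;
  (transitivity (x ^+ 2 + y ^+ 2 + z ^+ 2); [ring | rewrite E; ring]).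
Qed.

Lemma leq_card_fibers (T S : finType) (f : T -> S) (A : {set T}) (B : {set S}) c :
  {in A, forall x, f x \in B} ->
  (forall y, #|[set x in A | f x == y]| <= c)%N -> (#|A| <= c * #|B|)%N.
Proof.
move=> fAB le_c; rewrite -sum1_card (partition_big f [in B]) //= mulnC -sum_nat_const.
apply: leq_sum => y _; apply: leq_trans (le_c y).
by rewrite -sum1_card; apply/eq_leq/eq_bigl => x; rewrite inE.
Qed.

Lemma card_le2 (T : finType) (A : {set T}) (g : T -> T) :
  {in A &, forall x y, x = y \/ x = g y} -> (#|A| <= 2)%N.
Proof.
move=> Ag; have [->|[a aA]] := set_0Vmem A; first by rewrite cards0.
apply: leq_trans (_ : #|[set a; g a]| <= 2)%N; last by rewrite cards2; case: eqP.
apply/subset_leq_card/subsetP => x xA; rewrite !inE.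
by case: (Ag x a xA aA) => ->; rewrite eqxx ?orbT.
Qed.

(** Once coordinates [i] and [i + 1] are fixed, the third is a root of a monic quadratic whose two
    roots are exchanged by the move at [i + 2]. *)
Lemma card_markoff_fiber i c :
  (#|[set t : triple p | markoffb t & coord t i == c]| <= 2 * p)%N.
Proof.
rewrite -[p in leqRHS](card_Fp p_pr) -cardsT.
apply: (@leq_card_fibers _ _ (fun t => coord t (i + 1))) => // y.
apply: (@card_le2 _ _ (mv (i + 2%:R))) => t t'; rewrite !inE.
move=> /andP[/andP[Mt /eqP ti] /eqP ti1] /andP[/andP[Mt' /eqP t'i] /eqP t'i1].
have := markoff_coord i Mt'; have := markoff_coord i Mt.
rewrite ti ti1 t'i t'i1 => /eqP + /eqP.
rewrite -subr_eq0 => /eqP E; rewrite -subr_eq0 => /eqP E'.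
have /eqP : (coord t (i + 2%:R) - coord t' (i + 2%:R)) *
  (coord t (i + 2%:R) - (c * y - coord t' (i + 2%:R))) = 0.
  by rewrite -[RHS](subrr 0) -{1}E -E'; ring.
rewrite mulf_eq0 !subr_eq0 => /orP[] /eqP e; [left | right];
  apply: coord_inj => j; case: (ord3P i j) => ->;
  by rewrite ?coord_mv /vmove ?ord3_neq ?eqxx ?ord3_addA ?ti ?ti1 ?t'i ?t'i1 // ?e.
Qed.

Section ClosedFieldFiber.
Variables (K : closedFieldType) (iota : {rmorphism 'F_p -> K}).
Variables (c : 'F_p) (i : 'I_3) (u : K).
Hypotheses (c0 : c != 0) (cu : iota c = u + u^-1) (u0 : u != 0) (D0 : u - u^-1 != 0).

(* On the conic [x ^ 2 - c x y + y ^ 2 = - c ^ 2], with [c = u + 1 / u], the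
   product of [s = x - u y] and [x - y / u] is [- c ^ 2]. *)
Let s t := iota (coord t (i + 1)) - u * iota (coord t (i + 2%:R)).
Let D := u - u^-1.
(** Found by solving x - u y = s and x - y / u = - c ^ 2 / s for x and y, then multiplying by s. *)
Let P : 'I_3 -> {poly K} := fun j =>
  if j == i then (iota c)%:P
  else if j == i + 1 then (- (u^-1 / D)) *: 'X^2 - (u * iota c ^+ 2 / D)%:P
  else (- D^-1) *: 'X^2 - (iota c ^+ 2 / D)%:P.

Lemma size_fiber_poly j : size (P j) = ((j != i) : nat).*2.+1.
Proof.
have iota_c : iota c != 0 by rewrite fmorph_eq0.
have DV : D^-1 != 0 by rewrite invr_eq0.
rewrite /P; case: ifP => _; first by rewrite size_polyC iota_c.
by case: ifP => _; rewrite size_polyDl size_scale ?oppr_eq0 ?mulf_neq0 ?invr_eq0 //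
  size_polyXn ?size_polyN // (leq_ltn_trans (size_polyC_leq1 _)).
Qed.

Lemma fiber_tracked t : markoffb t -> coord t i = c ->
  tracked (s t) (iota \o coord t) (fun j => (j != i) : nat) P.
Proof.
move=> Mt ti j; have := congr1 iota (markoff_coord i Mt).
rewrite ti !rmorphD !rmorphM -!expr2 /s.
set x := iota (coord t (i + 1)); set y := iota (coord t (i + 2%:R)) => E.
(* Eliminating c ^ 2 leaves identities in u, x and y that never divide by s. *)
have Ec : iota c ^+ 2 = (u + u^-1) * x * y - x ^+ 2 - y ^+ 2 by rewrite -cu -E; ring.
have D1 : u * u - 1 != 0.
  by rewrite -[u * u - 1](_ : u * (u - u^-1) = _) ?mulf_neq0 // mulrBr divff.
case: (ord3P i j) => -> /=; rewrite /P ?ord3_neq ?eqxx /= ?ti ?expr0 ?expr1.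
- by rewrite mulr1 hornerC.
- rewrite hornerD hornerN hornerZ hornerXn hornerC Ec /D -/x; field; by rewrite ?D1 ?u0.
- rewrite hornerD hornerN hornerZ hornerXn hornerC Ec /D -/y; field; by rewrite ?D1 ?u0.
Qed.


(** The parameter [s] sends the fixed points in the fibre injectively to roots of the polynomial of
    [fixed_point_poly]. *)
Lemma card_fixed_fiber_closed l w : reduced (l :: w) -> last l w = i ->
  (#|[set t : triple p | [&& markoffb t, word_act (l :: w) t == t & coord t i == c]]|
     <= 2 ^ (size w).+2)%N.
Proof.
move=> red li.
have e0E j : ((j != i) : nat) = (j != last l w) by rewrite li.
have [Q Q0 [szQ rootQ]] := fixed_point_poly e0E size_fiber_poly red.
set A := [set t | _].
have A_tracked t : t \in A -> [/\ markoffb t, word_act (l :: w) t = t, coord t i = c &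
    tracked (s t) (iota \o coord t) (fun j => (j != i) : nat) P].
  by rewrite inE => /and3P[Mt /eqP wt /eqP ti]; split=> //; exact: fiber_tracked.
have s_inj : {in A &, injective s}.
  move=> t t' /A_tracked[Mt _ ti trk] /A_tracked[Mt' _ t'i trk'] st.
  (* If s were 0, tracking at [i + 1] would force the constant term - u c ^ 2 / D to vanish. *)
  have st0 : s t' != 0.
    apply/eqP => st0; have := trk' (i + 1).
    rewrite /P ord3_neq eqxx st0 /= expr1 mulr0.
    rewrite hornerD hornerN hornerZ hornerXn hornerC expr0n /= mulr0 add0r.
    move/eqP; rewrite eq_sym oppr_eq0 !mulf_eq0 invr_eq0 (negPf D0) (negPf u0) orbF.
    by rewrite fmorph_eq0 (negPf c0).
  apply: coord_inj => j; apply: (fmorph_inj iota); apply: (mulIf (expf_neq0 (j != i) st0)).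
  by have := trk j; rewrite st (trk' j) => <-.
rewrite -ltnS cardE -(size_map s); apply: leq_trans szQ.
apply: max_poly_roots => //.
- apply/allP => _ /mapP[t + ->]; rewrite mem_enum => /A_tracked[Mt wt ti trk].
  by apply: (rootQ _ _ trk); rewrite -coord_word_act wt.
- by rewrite map_inj_in_uniq ?enum_uniq // => t t'; rewrite !mem_enum; exact: s_inj.
Qed.

End ClosedFieldFiber.

Definition fixed_points w :=
  [set t : triple p | markoffb t & word_act w t == t].

Lemma card_fixed_fiber l w c : reduced (l :: w) ->
  c != 0 -> c != 2%:R -> c != - 2%:R ->
  (#|[set t in fixed_points (l :: w) | coord t (last l w) == c]| <= 2 ^ (size w).+2)%N.
Proof.
move=> red c0 c2 cN2; have [K [iota _]] := countable_algebraic_closure 'F_p.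
(* This solves u ^ 2 = c u - 1, that is u + 1 / u = c; excluding c = 2 and c = -2 rules out u = 1 /
   u. *)
have [u] := @solve_monicpoly K 2 (nth 0 [:: -1; iota c]) isT.
rewrite !big_ord_recr big_ord0 /= expr0 expr1 add0r mulr1 => uE.
have u0 : u != 0.
  by apply/eqP => u0; move/eqP: uE; rewrite u0 expr0n mulr0 addr0 eq_sym oppr_eq0 oner_eq0.
have cu : iota c = u + u^-1.
  apply: (mulIf u0); rewrite mulrDl mulVf // -expr2 uE; ring.
have D0 : u - u^-1 != 0.
  apply/eqP => D0; have uV : u^-1 = u by apply/esym/eqP; rewrite -subr_eq0 D0.
  have : u ^+ 2 == 1 by rewrite expr2 -{1}uV mulVf.
  rewrite sqrf_eq1 => /orP[] /eqP u1.
    case/eqP: c2; apply: (fmorph_inj iota).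
    by rewrite cu uV u1 rmorph_nat -natr1.
  case/eqP: cN2; apply: (fmorph_inj iota).
  by rewrite cu uV u1 rmorphN rmorph_nat; ring.
apply: leq_trans (card_fixed_fiber_closed c0 cu u0 D0 red erefl).
by apply/subset_leq_card/subsetP => t; rewrite !inE -andbA.
Qed.

(** The 6 accounts for the exceptional values 0, 2 and -2, whose fibres have at most 2 p points
    each; every other value contributes at most 2 ^ (size w + 2). *)
Lemma card_fixed_points l w : reduced (l :: w) ->
  (#|fixed_points (l :: w)| <= (2 ^ (size w).+2 + 6) * p)%N.
Proof.
move=> red; set i := last l w; set F := fixed_points _.
pose bad c := [set t : triple p | markoffb t & coord t i == c].
pose good := [set t in F | coord t i \notin [:: 0; 2%:R; - 2%:R]].
have sub : F \subset good :|: (bad 0 :|: (bad 2%:R :|: bad (- 2%:R))).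
  apply/subsetP => t tF; rewrite !inE; move: (tF); rewrite inE => /andP[-> ->] /=.
  by do 3![case: eqP => //=].
have le_good : (#|good| <= 2 ^ (size w).+2 * p)%N.
  rewrite -[p in leqRHS](card_Fp p_pr) -cardsT.
  apply: (@leq_card_fibers _ _ (fun t => coord t i)) => // c.
  have [cbad|] := boolP (c \in [:: 0; 2%:R; - 2%:R]).
    rewrite (_ : [set _ in _ | _] = set0) ?cards0 //; apply/setP => t.
    rewrite in_set0; apply/negP; rewrite inE => /andP[]; rewrite inE.
    by move=> /andP[_ tg] /eqP ti; rewrite ti cbad in tg.
  rewrite !inE !negb_or => /and3P[c0 c2 cN2].
  apply: leq_trans (card_fixed_fiber red c0 c2 cN2).
  by apply/subset_leq_card/subsetP => t; rewrite !inE => /andP[/andP[-> _] ->].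
apply: leq_trans (subset_leq_card sub) _.
apply: leq_trans (leq_card_setU _ _) _; rewrite mulnDl leq_add //.
apply: leq_trans (leq_card_setU _ _) _.
apply: leq_trans (leq_add (card_markoff_fiber _ _) (leq_card_setU _ _)) _.
apply: leq_trans (leq_add (leqnn _) (leq_add (card_markoff_fiber _ _) (card_markoff_fiber _ _))) _.
by rewrite -!mulnDl.
Qed.

End FixedPoints.

(** * A lower bound for the number of points *)

Lemma triple_eq (T : Type) (x y z x' y' z' : T) :
  (x, y, z) = (x', y', z') -> [/\ x = x', y = y' & z = z'].
Proof. by case=> -> -> ->. Qed.

Lemma card_Markoff (p : nat) :
  #|{: Markoff p}| = #|[set t : triple p | markoffb t]|.
Proof. by rewrite card_sig -cardsE; apply: eq_card => t; rewrite !inE. Qed.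

(** The second equality computes the conjugate factor x - z / v, which becomes the parameter when
    [v] is replaced by its inverse. *)
Lemma markoff_param (F : fieldType) (v s : F) :
  v != 0 -> s != 0 -> 1 - v * v != 0 ->
  let y := v + v^-1 in let z := (s + y ^+ 2 / s) / (v^-1 - v) in
  [/\ (s + v * z) ^+ 2 + y ^+ 2 + z ^+ 2 = (s + v * z) * y * z &
       s + v * z - v^-1 * z = - (y ^+ 2 / s)].
Proof. by move=> v0 s0 d0 y z; rewrite /z /y {y z}; split; field; rewrite v0 s0 mulNr d0. Qed.

Lemma addrV_eq (F : fieldType) (v w : F) : v != 0 -> w != 0 ->
  v + v^-1 = w + w^-1 -> v = w \/ v = w^-1.
Proof.
move=> v0 w0 vw; have /eqP : (v - w) * (v - w^-1) = 0.
  transitivity (v * (v + v^-1 - (w + w^-1))); first by field; rewrite v0 w0.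
  by rewrite vw subrr mulr0.
by rewrite mulf_eq0 !subr_eq0 => /orP[] /eqP; [left | right].
Qed.

(* The points [(v + 1/v, s + v z, z)] with [(x - v z) (x - z / v) = - y ^ 2]. *)
Lemma card_Markoff_ge (p : nat) : prime p ->
  ((p - 1) * (p - 3) <= 2 * #|{: Markoff p}|)%N.
Proof.
move=> p_pr.
pose good := [set vs : 'F_p * 'F_p | (vs.1 \notin [:: 0; 1; -1]) && (vs.2 != 0)].
pose point (vs : 'F_p * 'F_p) : triple p :=
  let: (v, s) := vs in let y := v + v^-1 in
  let z := (s + y ^+ 2 / s) / (v^-1 - v) in (s + v * z, y, z).
have nz (v : 'F_p) : v \notin [:: 0; 1; -1] -> v != 0 /\ 1 - v * v != 0.
  rewrite !inE !negb_or => /and3P[v0 v1 vN1]; split=> //.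
  rewrite (_ : 1 - v * v = (1 - v) * (v - -1)); last by ring.
  by rewrite mulf_neq0 // subr_eq0 // eq_sym.
have point_markoff vs : vs \in good -> markoffb (point vs).
  case: vs => v s; rewrite inE /= => /andP[/nz[v0 d1] s0].
  apply/andP; split; last by apply/eqP; case: (markoff_param v0 s0 d1).
  apply: contraNneq s0 => e; have [xE _ zE] := triple_eq e.
  by move: xE; rewrite zE mulr0 addr0 => ->.
have card_good : ((p - 3) * (p - 1) <= #|good|)%N.
  pose A := [set v : 'F_p | v \notin [:: 0; 1; -1]]; pose B := [set s : 'F_p | s != 0].
  have -> : good = setX A B by apply/setP => -[v s]; rewrite !inE.
  rewrite cardsX leq_mul //.
    rewrite leq_subLR -[p in leqLHS](card_Fp p_pr) -(cardsC A) addnC leq_add2r.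
    apply: leq_trans (subset_leq_card (_ : ~: A \subset [set:: [:: 0; 1; -1]])) _.
      by apply/subsetP => v; rewrite !inE negbK.
    by rewrite cardsE (leq_trans (card_size _)).
  rewrite leq_subLR -[p in leqLHS](card_Fp p_pr) -(cardsC B) addnC leq_add2r.
  apply: leq_trans (subset_leq_card (_ : ~: B \subset [set 0])) _; last by rewrite cards1.
  by apply/subsetP => v; rewrite !inE negbK.
apply: leq_trans (_ : #|good| <= _)%N; first by rewrite mulnC.
rewrite card_Markoff.
apply: (@leq_card_fibers _ _ point) => [vs|t]; first by rewrite inE; exact: point_markoff.
(* The second coordinate determines [v] up to inversion, and inversion exchanges the factors x - v z
   and x - z / v. *)
apply: (@card_le2 _ _ (fun vs => (vs.1^-1, - ((vs.1 + vs.1^-1) ^+ 2 / vs.2)))).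
move=> [v s] [v' s'].
rewrite inE => /andP[]; rewrite inE => /andP[/= /nz[v0 d1] s0] /eqP Evs.
rewrite inE => /andP[]; rewrite inE => /andP[/= /nz[v0' d1'] s0'] /eqP.
rewrite -Evs => e; have [xE yE zE] := triple_eq e.
case: (addrV_eq v0 v0' (esym yE)) => vE; [left | right].
  by move: xE; rewrite zE vE => /addIr ->.
by case: (markoff_param v0' s0' d1') => _ <-; rewrite xE zE -vE addrK.
Qed.

(** * Non-backtracking polynomials and reduced words *)

Fixpoint cheb_poly (F : nzRingType) (a : nat -> F) (d : nat) : {poly F} :=
  match d with
  | 0%N => 1
  | S d' => match d' with
    | 0%N => 'X
    | S d'' => cheb_poly a d' * 'X - (a d'')%:P * cheb_poly a d''
    end
  end.

Lemma trace_cheb_poly (F : fieldType) (a : nat -> F) (s : seq F) n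
    (A : 'M[F]_n) (B : nat -> 'M[F]_n) d :
  B 0%N = 1 -> B 1%N = A -> (forall k, B k.+2 = B k.+1 *m A - a k *: B k) ->
  char_poly A = \prod_(l <- s) ('X - l%:P) ->
  \tr (B d) = \sum_(l <- s) (cheb_poly a d).[l].
Proof.
case: n A B => [|n] A B B0 B1 Brec cA.
  have := congr1 (fun q : {poly F} => size q) cA.
  rewrite size_char_poly size_prod_XsubC => -[/esym/size0nil ->].
  by rewrite big_nil /mxtrace big_ord0.
rewrite -(trace_horner_char_poly _ cA); congr (\tr _).
suff [] : B d = horner_mx A (cheb_poly a d) /\ B d.+1 = horner_mx A (cheb_poly a d.+1) by [].
elim: d => [|d [IH0 IH1]]; first by rewrite B0 B1 rmorph1 horner_mx_X.
split=> //; rewrite Brec IH1 IH0 [cheb_poly a d.+2]/= rmorphB !rmorphM /=.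
by rewrite horner_mx_X horner_mx_C -!mulmxE mul_scalar_mx.
Qed.

Fixpoint reduced_words (d : nat) : seq (seq 'I_3) :=
  if d is d'.+1 then
    flatten [seq [seq i :: w | i <- enum 'I_3 & reduced (i :: w)] | w <- reduced_words d']
  else [:: [::]].

Lemma big_reduced_words (V : nmodType) (G : seq 'I_3 -> V) d :
  \sum_(w <- reduced_words d.+1) G w
  = \sum_(w <- reduced_words d) \sum_(i | reduced (i :: w)) G (i :: w).
Proof.
rewrite /= big_flatten big_map; apply: eq_bigr => w _.
by rewrite big_map big_filter big_enum_cond.
Qed.

Lemma reduced_wordsP d w : w \in reduced_words d -> reduced w /\ size w = d.
Proof.
elim: d w => [|d IH] w /=; first by rewrite inE => /eqP ->.
move=> /flattenP[_ /mapP[w' /IH[_ sz] ->] /mapP[i + ->]].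
by rewrite mem_filter /= sz => /andP[].
Qed.

Lemma card_reduced_cons w : reduced w ->
  #|[pred i | reduced (i :: w)]| = if w is [::] then 3%N else 2%N.
Proof.
case: w => [|j w] red; first by rewrite (eq_card (B := predT)) ?card_ord.
rewrite (eq_card (_ : _ =i predC1 j)) ?cardC1 ?card_ord // => i.
by rewrite !inE; move: red; rewrite /reduced /= => ->; rewrite andbT.
Qed.

(** A letter put before a reduced word either extends it or repeats its first letter, and then the
    pair cancels. A reduced word of length [d] arises by cancellation once for each letter that
    extends it: 3 if it is empty, 2 otherwise. *)
Lemma sum_cancel_words (V : zmodType) (G : seq 'I_3 -> V) d :
  (forall i w, G [:: i, i & w] = G w) ->
  \sum_(w <- reduced_words d.+1) \sum_i G (i :: w) =
  \sum_(w <- reduced_words d.+2) G w +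
  (\sum_(w <- reduced_words d) G w) *+ (if d is 0 then 3 else 2).
Proof.
move=> Gii.
transitivity (\sum_(w <- reduced_words d.+1)
  (\sum_(i | reduced (i :: w)) G (i :: w) + \sum_(i | ~~ reduced (i :: w)) G (i :: w))).
  by apply: eq_bigr => w _; exact: bigID.
rewrite big_split; congr (_ + _); first by rewrite [RHS]big_reduced_words.
rewrite big_reduced_words -sumrMnl.
rewrite big_seq [RHS]big_seq; apply: eq_bigr => w /reduced_wordsP[red sz].
rewrite (eq_bigr (fun=> G w)) => [|i redi].
  rewrite sumr_const card_reduced_cons //; congr (_ *+ _).
  by case: w d sz {red} => [|? ?] [].
rewrite (eq_bigl (pred1 i)) ?big_pred1_eq // => j.
by rewrite [reduced _](_ : _ = (j != i) && reduced (i :: w)) // redi andbT negbK.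
Qed.

(** * Word matrices and their traces *)

Section WordMatrices.
Variable p : nat.
Implicit Types (t : triple p) (i : 'I_3) (w : seq 'I_3).

Lemma mvK i : involutive (@mv p i).
Proof.
move=> t; apply: coord_inj => j; rewrite coord_mv /vmove !coord_mv /vmove.
by case: eqP => [->|//]; rewrite ?eqxx !ord3_neq opprB addrC subrK.
Qed.

Lemma markoffb_mv i t : markoffb t -> markoffb (mv i t).
Proof.
move=> Mt; have t0 : t != (0, 0, 0) by case: t Mt => [[x y] z] /andP[].
have mvt0 : mv i t != (0, 0, 0).
  apply: contraNneq t0 => e; rewrite -[t](mvK i) e; apply/eqP/coord_inj => j.
  have c0 k : coord ((0, 0, 0) : triple p) k = 0 by case: k => [[|[|[|//]]] ?].
  by rewrite coord_mv /vmove !c0 mulr0 subrr if_same.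
case: t Mt {t0} mvt0 => [[x y] z] /andP[_ /eqP E].
case: i => [[|[|[|//]]] ?]; rewrite /mv /= => ->; apply/eqP.
- transitivity (x ^+ 2 + y ^+ 2 + z ^+ 2 + y * z * (y * z - 2%:R * x)); first ring.
  by rewrite E; ring.
- transitivity (x ^+ 2 + y ^+ 2 + z ^+ 2 + x * z * (x * z - 2%:R * y)); first ring.
  by rewrite E; ring.
- transitivity (x ^+ 2 + y ^+ 2 + z ^+ 2 + x * y * (x * y - 2%:R * z)); first ring.
  by rewrite E; ring.
Qed.

Lemma markoffb_word_act w t : markoffb t -> markoffb (word_act w t).
Proof. by move=> Mt; elim: w => //= i w; exact: markoffb_mv. Qed.

Lemma big_vtx (V : nmodType) (F : triple p -> V) :
  \sum_(u : 'I_#|{: Markoff p}|) F (vtx u) = \sum_(t | markoffb t) F t.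
Proof.
rewrite -[RHS]/(\sum_(t in [pred t | markoffb t]) F t) [RHS]big_sub.
by rewrite -[LHS](@big_enum_val _ _ _ _ {: Markoff p} (fun x : Markoff p => F (val x))).
Qed.

Lemma perm_matrix_mul (m m' : triple p -> triple p) :
  (forall t, markoffb t -> markoffb (m t)) ->
  perm_matrix m *m perm_matrix m' = perm_matrix (m' \o m).
Proof.
move=> mM; apply/matrixP => u v; rewrite !mxE.
pose F t : R := (m (vtx u) == t)%:R * (m' t == vtx v)%:R.
rewrite (eq_bigr (fun k => F (vtx k))) => [|k _]; last by rewrite !mxE.
rewrite big_vtx (bigD1 (m (vtx u))) /= ?mM ?(valP (enum_val u)) //.
rewrite big1 ?addr0 => [|t /andP[_ tu]]; first by rewrite /F eqxx mul1r.
by rewrite /F eq_sym (negPf tu) mul0r.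
Qed.

Lemma trace_perm_matrix w :
  \tr (perm_matrix (@word_act p w)) = #|@fixed_points p w|%:R :> R.
Proof.
rewrite /mxtrace (eq_bigr (fun u => (word_act w (vtx u) == vtx u)%:R)) => [|u _].
  rewrite (big_vtx (fun t => (word_act w t == t)%:R)) -natr_sum; congr (_%:R).
  rewrite -sum1dep_card big_mkcondr; apply: eq_bigr => t _; by case: (_ == _).
by rewrite !mxE.
Qed.

Definition words_mx d : 'M[R]_#|{: Markoff p}| :=
  \sum_(w <- reduced_words d) perm_matrix (@word_act p w).

Lemma markoff_adjE : markoff_adj p = \sum_i perm_matrix (@mv p i).
Proof. by rewrite !big_ord_recl big_ord0 addr0 addrA. Qed.

Lemma words_mx0 : words_mx 0 = 1.
Proof.
rewrite /words_mx big_seq1; apply/matrixP => u v; rewrite !mxE /=.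
by rewrite (inj_eq val_inj) (inj_eq enum_val_inj).
Qed.

Lemma words_mx1 : words_mx 1 = markoff_adj p.
Proof.
rewrite markoff_adjE /words_mx big_reduced_words big_seq1.
by apply: eq_bigr => i _; apply/matrixP => u v; rewrite !mxE.
Qed.

(** Right multiplication by the matrix of [mv i] prepends [i] to a word. Words are counted, not
    walks, so the recurrence stays exact where a move fixes a vertex. *)
Lemma words_mx_rec d :
  words_mx d.+2 = words_mx d.+1 *m markoff_adj p - (if d is 0 then 3%:R else 2%:R) *: words_mx d.
Proof.
have mulA : words_mx d.+1 *m markoff_adj p =
    \sum_(w <- reduced_words d.+1) \sum_i perm_matrix (@word_act p (i :: w)).
  rewrite markoff_adjE mulmx_suml; apply: eq_bigr => w _.
  rewrite mulmx_sumr; apply: eq_bigr => i _; apply: perm_matrix_mul => t.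
  exact: markoffb_word_act.
rewrite mulA (sum_cancel_words (G := fun w => perm_matrix (@word_act p w))).
  by case: d {mulA} => [|d]; rewrite scaler_nat addrK.
by move=> i w; apply/matrixP => u v; rewrite !mxE /= mvK.
Qed.

Lemma sum_cheb_poly_eigenvalues (a : nat -> R) d s :
  a =1 (fun d => if d is 0 then 3%:R else 2%:R) ->
  eigenvalues_with_mult (markoff_adj p) s ->
  \sum_(l <- s) (cheb_poly a d).[l] =
  (\sum_(w <- reduced_words d) #|@fixed_points p w|)%:R.
Proof.
move=> aE cA; rewrite -(trace_cheb_poly d words_mx0 words_mx1 _ cA) => [|k].
  by rewrite raddf_sum natr_sum; apply: eq_bigr => w _; exact: trace_perm_matrix.
by rewrite words_mx_rec aE.
Qed.

End WordMatrices.

(** * From fixed-point counts to equidistribution *)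

Local Open Scope R_scope.

Lemma natr_INR (n : nat) : n%:R = INR n :> R.
Proof. by elim: n => // n IH; rewrite mulrSr IH S_INR. Qed.

Lemma horner_cheb_poly (a : nat -> R) d x : (cheb_poly a d).[x] = cheb_rec a d x.
Proof.
suff [] : (cheb_poly a d).[x] = cheb_rec a d x /\
  (cheb_poly a d.+1).[x] = cheb_rec a d.+1 x by [].
elim: d => [|d [IH0 IH1]]; first by rewrite /= hornerC hornerX.
split => //; rewrite [cheb_poly a d.+2]/= hornerD hornerN !hornerM hornerX hornerC.
by rewrite IH0 [X in GRing.mul X _]IH1 mulrC.
Qed.

Definition km_coef (d : nat) : R := match d with 0%nat => 3 | S _ => 2 end.

Lemma sum_fixed_points_le p d : prime p ->
  (\sum_(w <- reduced_words d.+1) #|@fixed_points p w|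
     <= size (reduced_words d.+1) * (2 ^ d.+2 + 6) * p)%N.
Proof.
move=> p_pr; rewrite -mulnA -sum1_size big_distrl /= -/(reduced_words d.+1).
rewrite big_seq [leqRHS]big_seq; apply: leq_sum => w /reduced_wordsP[red sz].
case: w red sz => [|l w] red //= [sz]; rewrite mul1n -sz.
exact: card_fixed_points.
Qed.

Lemma sum_fixed_points_le_card p d :
  (\sum_(w <- reduced_words d) #|@fixed_points p w|
     <= size (reduced_words d) * #|{: Markoff p}|)%N.
Proof.
rewrite -sum1_size big_distrl /=; apply: leq_sum => w _.
rewrite mul1n card_Markoff; apply/subset_leq_card/subsetP => t.
by rewrite !inE => /andP[].
Qed.

Lemma sum_fixed_points0 p :
  (\sum_(w <- reduced_words 0) #|@fixed_points p w| = #|{: Markoff p}|)%N.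
Proof.
rewrite big_seq1 card_Markoff; apply: eq_card => t.
by rewrite !inE eqxx andbT.
Qed.

Lemma ratio_le (N M S : nat) : (N <= S * M)%N -> 0 <= / INR M * INR N <= INR S.
Proof.
move=> le_N; case: M le_N => [|M] le_N.
  (* For M = 0 the inverse is 0 by convention. *)
  by rewrite Rinv_0 Rmult_0_l; split; [lra | exact: pos_INR].
have M0 : 0 < INR M.+1 by apply: lt_0_INR; lia.
have N0 := pos_INR N; have : INR N <= INR S * INR M.+1.
  by rewrite -mult_INR; apply: le_INR; lia.
move=> le_N'; split.
  by apply: Rmult_le_pos => //; apply/Rlt_le/Rinv_0_lt_compat.
by apply: (Rmult_le_reg_l _ _ _ M0); rewrite -Rmult_assoc Rinv_r; lra.
Qed.

Lemma ratio_le_div (N M K p : nat) : (0 < p)%N ->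
  (N <= K * p)%N -> (p * p <= 10 * M)%N -> 0 <= / INR M * INR N <= INR (10 * K) / INR p.
Proof.
move=> p0 le_N le_M.
have p0' : 0 < INR p by apply: lt_0_INR; lia.
have M0 : 0 < INR M by apply: lt_0_INR; nia.
have N0 := pos_INR N; have Mi : 0 < / INR M by exact: Rinv_0_lt_compat.
split; first exact: Rmult_le_pos (Rlt_le _ _ Mi) N0.
apply: (Rmult_le_reg_l _ _ _ M0); rewrite -Rmult_assoc Rinv_r; last lra.
apply: (Rmult_le_reg_r _ _ _ p0').
have -> : INR M * (INR (10 * K) / INR p) * INR p = INR M * INR (10 * K).
  by rewrite /Rdiv -!Rmult_assoc Rmult_assoc Rinv_l; lra.
rewrite Rmult_1_l -!mult_INR; apply: le_INR; apply/leP.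
by apply: leq_trans (_ : K * p * p <= _)%N; nia.
Qed.

(** The integral is an existential value tied by [is_RInt], so linear combinations carry
    integrability along. *)
Definition equidistributed (f : {poly R}) : Prop :=
  exists C v : R,
    is_RInt (fun l : R => f.[l] * rho3 l) (- (2 * sqrt 2)) (2 * sqrt 2) v /\
    forall p : nat, prime p -> odd p ->
    forall s : seq R, eigenvalues_with_mult (markoff_adj p) s ->
      Rabs (/ INR #|{: Markoff p}| * (\sum_(l <- s) f.[l]) - v) <= C / INR p.

Lemma equidistributed_cheb_poly d : equidistributed (cheb_poly km_coef d).
Proof.
set S := size (reduced_words d).
(* The first summand covers p at most 3 through the trivial bound S + 1; the second covers p at
   least 5, where p ^ 2 is at most 10 M. *)
exists (INR (3 * S.+1 + 10 * (S * (2 ^ d.+1 + 6)))), (if d is 0%nat then 1 else 0); split.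
  apply: (@is_RInt_eq _ _ _ _ _ _ (@is_RInt_kmpoly_rho3 d)) => x.
  by rewrite horner_cheb_poly.
move=> p p_pr p_odd s eig.
have aE : km_coef =1 (fun d => if d is 0%nat then 3%:R else 2%:R).
  by case=> [|?]; rewrite natr_INR /=; lra.
rewrite (sum_cheb_poly_eigenvalues _ aE eig) natr_INR.
set N := \sum_(_ <- _) _; set M := #|{: Markoff p}|.
have p2 := prime_gt1 p_pr.
have p0 : 0 < INR p by apply: lt_0_INR; lia.
have := ratio_le (sum_fixed_points_le_card p d); rewrite -/N -/M -/S.
set r := / INR M * INR N => r_bnd.
have [p3|p4] := leqP p 3.
  apply: (Rle_trans _ (INR S.+1)).
    rewrite S_INR; apply: Rabs_le; move: r_bnd; case: (d) => [|?]; lra.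
  apply: (Rmult_le_reg_r _ _ _ p0); rewrite /Rdiv Rmult_assoc Rinv_l; last lra.
  rewrite Rmult_1_r -mult_INR; apply: le_INR; apply/leP; nia.
have p5 : (4 < p)%N by rewrite ltn_neqAle p4 andbT; apply: contraTneq p_odd => <-.
have := card_Markoff_ge p_pr; rewrite -/M => le_M.
(* For p at least 5, p ^ 2 is at most 5 (p - 1) (p - 3). *)
have {}le_M : (p * p <= 10 * M)%N by nia.
case: d @S @N @r r_bnd => [|d] S N r.
  (* In degree 0 the empty word fixes every point and the average is exactly 1. *)
  rewrite /r /N sum_fixed_points0 -/M => _.
  have M0 : INR M <> 0 by apply: not_0_INR; nia.
  rewrite Rinv_l // Rminus_diag Rabs_R0; apply: Rdiv_le_0_compat => //; exact: pos_INR.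
move=> _; have := ratio_le_div (ltnW p2) (sum_fixed_points_le d p_pr) le_M.
rewrite -/N -/r Rminus_0_r => -[r0 r1]; rewrite Rabs_pos_eq //.
apply: Rle_trans r1 _; apply: Rmult_le_compat_r; first exact/Rlt_le/Rinv_0_lt_compat.
by apply: le_INR; lia.
Qed.

Lemma equidistributedD_scale (c : R) (f g : {poly R}) :
  equidistributed f -> equidistributed g -> equidistributed (GRing.add f (GRing.mul c%:P g)).
Proof.
move=> [C [v [If Bf]]] [D [w [Ig Bg]]].
have E x : (GRing.add f (GRing.mul c%:P g)).[x] = f.[x] + c * g.[x].
  by rewrite hornerD hornerM hornerC.
exists (C + Rabs c * D), (v + c * w); split.
  have If_Ig := is_RInt_plus _ _ _ _ _ _ If (is_RInt_scal _ _ _ c _ Ig).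
  apply: (@is_RInt_eq _ _ _ _ _ _ If_Ig) => x; rewrite E /plus /scal /= /mult /=; lra.
move=> p p_pr p_odd s eig; have := Bf p p_pr p_odd s eig; have := Bg p p_pr p_odd s eig.
have -> : \sum_(l <- s) (GRing.add f (GRing.mul c%:P g)).[l] =
    \sum_(l <- s) f.[l] + c * \sum_(l <- s) g.[l].
  rewrite -[RHS]/(GRing.add (\sum_(l <- s) f.[l]) (GRing.mul c (\sum_(l <- s) g.[l]))).
  rewrite mulr_sumr -big_split; apply: eq_bigr => l _.
  by rewrite hornerD hornerM hornerC.
set m := / INR _; set a := (X in m * X - w); set b := (X in m * X - v) => ha hb.
have -> : m * (b + c * a) - (v + c * w) = (m * b - v) + c * (m * a - w) by lra.
apply: Rle_trans (Rabs_triang _ _) _; rewrite Rabs_mult.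
have := Rmult_le_compat_l _ _ _ (Rabs_pos c) ha.
have -> : (C + Rabs c * D) / INR p = C / INR p + Rabs c * (D / INR p) by rewrite /Rdiv; lra.
lra.
Qed.

(** Multiplying the polynomial of index d > 0 by ['X] gives a combination of those of index d + 1
    and d - 1. Induction on [f] with [d] free thus replaces an expansion in this basis; d = 0 gives
    [f] itself. *)
Lemma equidistributed_mul_cheb_poly f d :
  equidistributed (GRing.mul (cheb_poly km_coef d) f).
Proof.
have eq0 g : equidistributed g -> equidistributed 0.
  move=> eg; have := equidistributedD_scale (GRing.opp 1) eg eg.
  by rewrite polyCN mulN1r subrr.
elim/poly_ind: f d => [|f c IH] d.
  by rewrite mulr0; apply: eq0 (equidistributed_cheb_poly d).
rewrite mulrDr [X in GRing.add _ X]mulrC; apply: equidistributedD_scale; last first.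
  exact: equidistributed_cheb_poly.
have -> : GRing.mul (cheb_poly km_coef d) (GRing.mul f 'X) =
    GRing.mul (GRing.mul (cheb_poly km_coef d) 'X) f by rewrite mulrA mulrAC.
case: d => [|d]; first by rewrite mul1r; exact: (IH 1%N).
have -> : GRing.mul (cheb_poly km_coef d.+1) 'X =
    GRing.add (cheb_poly km_coef d.+2) (GRing.mul (km_coef d)%:P (cheb_poly km_coef d)).
  by rewrite [cheb_poly _ d.+2]/= subrK.
by rewrite mulrDl -mulrA; apply: equidistributedD_scale.
Qed.

Theorem theorem1p2 :
  forall f : {poly R},
  exists C : R,
  exists pr : Riemann_integrable (fun l : R => f.[l] * rho3 l)
                (- (2 * sqrt 2)) (2 * sqrt 2),
  forall p : nat, prime p -> odd p ->
  forall s : seq R, eigenvalues_with_mult (markoff_adj p) s ->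
    Rabs (/ INR #|{: Markoff p}| * (\sum_(l <- s) f.[l]) - RiemannInt pr)
      <= C / INR p.
Proof.
move=> f; have [C [v [If Bf]]] := equidistributed_mul_cheb_poly f 0.
rewrite mul1r in If Bf.
exists C; have pr := ex_RInt_Reals_0 _ _ _ (ex_intro _ v If).
by exists pr; rewrite -RInt_Reals (is_RInt_unique _ _ _ _ If).
Qed.
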